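(* Let $(X,A_\tau,P)$ be a fully probabilistic transition system. The function $\tilde\mu_P:\mathcal O_{\mathrm{Path}(X)}\to[0,\infty]$, $\tilde\mu_P(U)=\mu_P(U^\star)=\sum_{p\in U^\star}\mu_P(p)$, is a locally finite and Scott-continuous valuation.
   Context: Fix a set $A$, $\tau\notin A$, $A_\tau=A\cup\{\tau\}$, $A_\tau^*$ finite words, $\epsilon$ the empty word, ${\downarrow}\sigma$ the set of prefixes of $\sigma$. A path on $X$ is a function $p$ into $X$ with domain ${\downarrow}\sigma$ for some $\sigma\in A_\tau^*$; $\mathrm{Path}(X)$ is ordered by $p\preceq q$ iff $\mathrm{dom}\,p\subseteq\mathrm{dom}\,q$ and $q$ agrees with $p$ on $\mathrm{dom}\,p$. $\mathcal O_{\mathrm{Path}(X)}$ is the Alexandroff topology: open sets are upward closed subsets. $U^\star=\{p\in U\mid\{q\mid q\preceq p\}\cap U=\{p\}\}$. A fully probabilistic transition system is $(X,A_\tau,P)$ with $X$, $A_\tau$ countable, $P:X\times A_\tau\times X\to[0,1]$, each $\{(a,x')\mid P(x,a,x')>0\}$ finite and $\sum_{(a,x')}P(x,a,x')\in\{0,1\}$. An execution from $x$ is a path with $p(\epsilon)=x$ and $P(p(\sigma),a,p(\sigma a))>0$ for all $\sigma a\in\mathrm{dom}\,p$; $\mu_P(p)=\prod_{\sigma a\in\mathrm{dom}\,p}P(p(\sigma),a,p(\sigma a))$ if $p$ is an execution from some state, else $0$. Infinite sums are suprema of finite partial sums. A valuation is $\mu:\mathcal O\to[0,\infty]$ with $\mu(\emptyset)=0$,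 monotone, modular ($\mu(U)+\mu(U')=\mu(U\cup U')+\mu(U\cap U')$); Scott-continuous if $\mu(\bigcup_iU_i)=\sup_i\mu(U_i)$ for directed families; locally finite if every point has an open neighbourhood of finite value. *)

(* Defs.v *)
(* MathComp / MathComp-Analysis *)
From HB Require Import structures.
From mathcomp Require Import all_boot all_order all_algebra.
From mathcomp Require Import all_classical all_reals all_analysis.

Set Implicit Arguments.
Unset Strict Implicit.
Unset Printing Implicit Defensive.

Import Order.TTheory GRing.Theory Num.Theory.

Local Open Scope classical_set_scope.
Local Open Scope ring_scope.

(* The letter tau not in A is None, so A_tau is option A; A_tau^* is
   seq (option A). A function with domain D into X is represented by a
   function into option X that is defined (is not None) exactly on D. *)
Record Path (A : eqType) (X : Type) : Type := MkPath {
  path_fun :> seq (option A) -> option X;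
  path_dom_prefixes :
    exists sigma : seq (option A), forall s, isSome (path_fun s) = prefix s sigma
}.

HB.instance Definition _ (A : eqType) (X : Type) := gen_eqMixin (Path A X).
HB.instance Definition _ (A : eqType) (X : Type) := gen_choiceMixin (Path A X).

Definition path_dom (A : eqType) (X : Type) (p : Path A X)
  : set (seq (option A)) := [set s | isSome (p s)].

Definition path_le (A : eqType) (X : Type) (p q : Path A X) : Prop :=
  path_dom p `<=` path_dom q /\ forall s, path_dom p s -> q s = p s.

Definition up_closed (A : eqType) (X : Type) (U : set (Path A X)) : Prop :=
  forall p q, U p -> path_le p q -> U q.

Section Alexandroff.
Context (A : eqType) (X : Type).

Lemma up_closedT : up_closed [set: Path A X].
Proof. by []. Qed.

Lemma up_closedI : setI_closed (@up_closed A X).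
Proof.
by move=> U V hU hV p q [Up Vp] pq; split; [exact: hU pq | exact: hV pq].
Qed.

Lemma up_closed_bigU (I : Type) (F : I -> set (Path A X)) :
  (forall i, up_closed (F i)) -> up_closed (\bigcup_i F i).
Proof. by move=> hF p q [i _ Fip] pq; exists i => //; exact: hF pq. Qed.

HB.instance Definition _ :=
  isOpenTopological.Build (Path A X) up_closedT up_closedI up_closed_bigU.

Lemma open_PathE (U : set (Path A X)) : open U <-> up_closed U.
Proof. by []. Qed.

End Alexandroff.

Definition star (A : eqType) (X : Type) (U : set (Path A X))
  : set (Path A X) :=
  [set p | U p /\ [set q | path_le q p] `&` U = [set p]].

Record fully_probabilistic (R : realType) (A X : countType)
    (P : X -> option A -> X -> R) : Prop := {
  fp_ge0 : forall x a x', 0 <= P x a x';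
  fp_le1 : forall x a x', P x a x' <= 1;
  fp_finite : forall x,
    finite_set [set ax : option A * X | 0 < P x ax.1 ax.2];
  fp_sum : forall x,
    let total := \esum_(ax in [set: option A * X]) (P x ax.1 ax.2)%:E in
    total = 0%E \/ total = 1%E
}.

(* P(p(sigma), a, p(sigma a)); the default value 0 is never used when
   sigma a is in the domain of p, since sigma is then in it as well. *)
Definition step_prob (R : realType) (A X : countType)
    (P : X -> option A -> X -> R) (p : Path A X)
    (s : seq (option A)) (a : option A) : R :=
  if (p s, p (rcons s a)) is (Some x, Some x') then P x a x' else 0.

Definition execution_from (R : realType) (A X : countType)
    (P : X -> option A -> X -> R) (x : X) (p : Path A X) : Prop :=
  p [::] = Some x /\
  forall s a, path_dom p (rcons s a) -> 0 < step_prob P p s a.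

(* The product ranges over a finite set, as path_dom p is finite. *)
Definition muP (R : realType) (A X : countType)
    (P : X -> option A -> X -> R) (p : Path A X) : R :=
  if `[< exists x, execution_from P x p >] then
    \big[*%R/1]_(sa \in [set sa : seq (option A) * option A |
                          path_dom p (rcons sa.1 sa.2)])
      step_prob P p sa.1 sa.2
  else 0.

Definition muP_tilde (R : realType) (A X : countType)
    (P : X -> option A -> X -> R) (U : set (Path A X)) : \bar R :=
  \esum_(p in star U) (muP P p)%:E.

(* A function on the open sets of T with values in [0, +oo] is represented by
   a function on all sets, of which only the values on open sets matter. *)
Record valuation (R : realType) (T : topologicalType)
    (mu : set T -> \bar R) : Prop := {
  valuation_ge0 : forall U, open U -> (0 <= mu U)%E;
  valuation0 : mu set0 = 0%E;
  valuation_mono : forall U V, open U -> open V -> U `<=` V ->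
    (mu U <= mu V)%E;
  valuation_modular : forall U V, open U -> open V ->
    (mu U + mu V = mu (U `|` V) + mu (U `&` V))%E
}.

(* Directed families are nonempty. *)
Definition directed_family (T I : Type) (F : I -> set T) : Prop :=
  inhabited I /\
  forall i j, exists k, F i `<=` F k /\ F j `<=` F k.

Definition scott_continuous (R : realType) (T : topologicalType)
    (mu : set T -> \bar R) : Prop :=
  forall (I : Type) (F : I -> set T),
    (forall i, open (F i)) -> directed_family F ->
    mu (\bigcup_i F i) = ereal_sup (range (fun i => mu (F i))).

Definition locally_finite_valuation (R : realType) (T : topologicalType)
    (mu : set T -> \bar R) : Prop :=
  forall x : T, exists U : set T, [/\ open U, U x & (mu U < +oo)%E].

(* Main.v *)
Require Import Defs.
From mathcomp Require Import all_boot all_order all_algebra.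
From mathcomp Require Import all_classical all_reals all_analysis.
From mathcomp Require Import finmap.

(** A path is a start state [x] together with a list [l] of labelled steps, and
    its measure is the product of the step probabilities along [l]. The weights
    of pairwise incomparable extensions of a path [p] add up to at most the
    weight of [p] (Kraft's inequality, by induction on the length: the outgoing
    probabilities of a state add up to at most 1). Monotonicity follows, since
    for [U `<=` V] each element of [star U] lies above a unique element of
    [star V]. The paths below a given one form a finite chain, so [star U] and
    [star V] have the same union and intersection as [star (U `|` V)] and
    [star (U `&` V)], whence modularity. For Scott continuity, a finite subset
    of [star (\bigcup_i F i)] lies in one [F k] by directedness, and hence in
    [star (F k)]. *)

(* Imported again because mathcomp's path.v also has a path_le. *)
Import Defs.

Set Implicit Arguments.
Unset Strict Implicit.
Unset Printing Implicit Defensive.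

Import Order.TTheory GRing.Theory Num.Theory.

Local Open Scope classical_set_scope.
Local Open Scope ring_scope.

Lemma prefix_comparable (T : eqType) (s1 s2 s : seq T) :
  prefix s1 s -> prefix s2 s -> prefix s1 s2 || prefix s2 s1.
Proof.
elim: s s1 s2 => [|a s IH] [|b s1] [|c s2] //=.
by case: eqP => // -> h1; case: eqP => // -> h2; rewrite eqxx; exact: IH.
Qed.

(** * Sums of families over arbitrary index sets *)

Section esum_extra.
Context (R : realType) (I : choiceType).
Local Open Scope ereal_scope.

(** The factor [c] comes out of every finite partial sum. It serves to split off a first step or a
    common initial segment. *)
Lemma esum_scale_le (S : set I) (f : I -> R) (c : R) :
  (0 <= c)%R -> \esum_(i in S) (f i)%:E <= 1 ->
  \esum_(i in S) (c * f i)%:E <= c%:E.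
Proof.
move=> c0 f1; apply: ge_ereal_sup => _ [F [finF FS] <-].
rewrite fsumEFin// -mulr_fsumr lee_fin ler_piMr//.
rewrite -lee_fin -fsumEFin//; apply: le_trans f1.
by apply: esum_ge; exists F.
Qed.

(* [esum_bigcupT] only covers unions indexed by [nat]. *)
Lemma esum_disjoint_bigcup (J : choiceType) (K : set J) (S : J -> set I)
    (a : I -> \bar R) :
  trivIset K S -> (forall i, 0 <= a i) ->
  \esum_(i in \bigcup_(k in K) S k) a i =
  \esum_(k in K) \esum_(i in S k) a i.
Proof.
move=> tS a0; rewrite esum_esum//.
(* The double sum runs over pairs [(k, i)]; disjointness makes [snd] injective on them. *)
rewrite -(@esum_image _ _ _ _ snd); last first.
  move=> [k i] [l j] /set_mem[/= Kk Ski] /set_mem[/= Kl Slj] ij; subst j.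
  by congr pair; apply: (tS k l) => //; exists i.
congr esum; apply/seteqP; split=> [i [k Kk Ski]|_ [[k i] [Kk Ski] <-]].
  by exists (k, i).
by exists k.
Qed.

(** Common elements count twice on either side; stated additively, since the sums may be
    infinite. *)
Lemma esumU_add_esumI (S S' : set I) (a : I -> \bar R) :
  (forall i, 0 <= a i) ->
  \esum_(i in S) a i + \esum_(i in S') a i =
  \esum_(i in S `|` S') a i + \esum_(i in S `&` S') a i.
Proof.
move=> a0; rewrite [in RHS](esumID S)// setUK.
rewrite [in LHS](esumID S S')// addeCA [S' `&` S]setIC.
by rewrite setIUl setICr set0U [RHS]addeC.
Qed.

End esum_extra.

(** * The order on paths and minimal elements of sets of paths *)

Section Path_order.
Context (A : eqType) (X : Type).
Implicit Types (p q r : Path A X) (U V : set (Path A X)).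

Lemma eq_Path p q : path_fun p =1 path_fun q -> p = q.
Proof.
case: p q => [f hf] [g hg] /= /funext fg; rewrite -fg in hg *.
by congr MkPath; exact: Prop_irrelevance.
Qed.

Lemma path_le_refl p : path_le p p. Proof. by split. Qed.

Lemma path_le_trans q p r : path_le p q -> path_le q r -> path_le p r.
Proof.
move=> [pq hpq] [qr hqr]; split=> [s /pq/qr//|s ps].
by rewrite hqr ?hpq//; exact: pq.
Qed.

Lemma path_le_anti p q : path_le p q -> path_le q p -> p = q.
Proof.
move=> [pq hpq] [qp _]; apply: eq_Path => s.
have [ps|ps] := pselect (path_dom p s); first by rewrite hpq.
have qs : ~ path_dom q s by move/qp.
by move: ps qs; rewrite /path_dom/=; case: (p s) (q s) => [?|] [?|].
Qed.

(** The words generating the domains of [q] and [r] are prefixes of the one for [p], hence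
    comparable, and on their domains both paths agree with [p]. *)
Lemma path_le_total p q r :
  path_le q p -> path_le r p -> path_le q r \/ path_le r q.
Proof.
move=> [qp hq] [rp hr].
have [[s hs] [t ht] [u hu]] :=
  And3 (path_dom_prefixes q) (path_dom_prefixes r) (path_dom_prefixes p).
have su : prefix s u by rewrite -hu; apply: qp; rewrite /path_dom/= hs prefix_refl.
have tu : prefix t u by rewrite -hu; apply: rp; rewrite /path_dom/= ht prefix_refl.
have dom_le (v w : Path A X) (a b : seq (option A)) :
    (forall x, isSome (v x) = prefix x a) -> (forall x, isSome (w x) = prefix x b) ->
    prefix a b -> path_dom v `<=` path_dom w.
  by move=> va wb ab x; rewrite /path_dom/= va wb => /prefix_trans; exact.
have /orP[st|ts] := prefix_comparable su tu; [left|right].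
- have qr := dom_le _ _ _ _ hs ht st.
  by split=> // x qx; rewrite -hq// hr//; exact: qr.
- have rq := dom_le _ _ _ _ ht hs ts.
  by split=> // x rx; rewrite -hr// hq//; exact: rq.
Qed.

Lemma starP U p : star U p <-> U p /\ forall q, path_le q p -> U q -> q = p.
Proof.
split=> [[Up e]|[Up h]].
  by split=> // q qp Uq; have : [set q | path_le q p] `&` U `<=` [set p];
    [rewrite e | apply].
split=> //; apply/seteqP; split=> [q [qp Uq]|q ->]; first exact: h.
by split=> //; exact: path_le_refl.
Qed.

(* The least element of U below p exists because the domain of p is finite. *)
Lemma star_below U p : U p -> exists2 q, star U q & path_le q p.
Proof.
have [s hs] := path_dom_prefixes p.
have [n] := ubnP (size s); elim: n p s hs => // n IH p s hs; rewrite ltnS => sn Up.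
have [h|] := pselect (forall q, path_le q p -> U q -> q = p).
  by exists p; [exact/starP | exact: path_le_refl].
move=> /existsNP[q /not_implyP[qp /not_implyP[Uq qNp]]].
have [t ht] := path_dom_prefixes q.
have ts : prefix t s by rewrite -hs; apply: qp.1; rewrite /path_dom/= ht prefix_refl.
(* A prefix [t] no shorter than [s] would be [s] itself, forcing [q = p]. *)
have lt : (size t < size s)%N.
  rewrite ltnNge; apply/negP => st; apply: qNp; apply: path_le_anti => //.
  have e : t = s.
    by move: ts; rewrite prefixE take_oversize// => /eqP.
  have pq : path_dom p `<=` path_dom q by move=> x; rewrite /path_dom/= hs ht e.
  by split=> // x px; rewrite qp.2//; exact: pq.
have [r Ur rq] := IH q t ht (leq_trans lt sn) Uq.
by exists r => //; exact: path_le_trans qp.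
Qed.

(** The delicate case is [p] minimal in the intersection but in neither set: then some [q] in [U]
    and [r] in [V] lie strictly below [p]. They are comparable, so the larger one is in both sets by
    upward closure, against minimality. *)
Lemma starU_starI U V : up_closed U -> up_closed V ->
  star (U `|` V) `|` star (U `&` V) = star U `|` star V.
Proof.
move=> hU hV; apply/seteqP; split=> p.
- case=> /starP[UVp hp].
  + case: UVp => ?; [left|right]; apply/starP; split=> // q qp ?; apply: hp => //.
    * by left.
    * by right.
  + case: UVp => Up Vp; apply: contrapT => /not_orP[/starP nU /starP nV].
    have : ~ forall q, path_le q p -> U q -> q = p by move=> h; exact: nU.
    move=> /existsNP[q /not_implyP[qp /not_implyP[Uq qNp]]].
    have : ~ forall q, path_le q p -> V q -> q = p by move=> h; exact: nV.
    move=> /existsNP[r /not_implyP[rp /not_implyP[Vr rNp]]].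
    have [qr|rq] := path_le_total qp rp.
    * by apply: rNp; apply: hp => //; split=> //; exact: hU qr.
    * by apply: qNp; apply: hp => //; split=> //; exact: hV rq.
- move=> h; have {h} h : (star U p \/ star V p) by [].
  have [[Up Vp]|UV] := pselect (U p /\ V p).
    right; apply/starP; split=> // q qp [Uq Vq].
    by case: h => /starP[_]; exact.
  left; case: h => /starP[Wp hp]; apply/starP; (split; first by [left|right]).
  + move=> q qp [/(hp _ qp)//|Vq]; case: UV; split=> //; exact: hV qp.
  + move=> q qp [Uq|/(hp _ qp)//]; case: UV; split=> //; exact: hU qp.
Qed.

Lemma starU_cap_starI U V :
  star (U `|` V) `&` star (U `&` V) = star U `&` star V.
Proof.
apply/seteqP; split=> p.
- move=> [/starP[_ h] /starP[[Up Vp] _]].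
  by split; apply/starP; split=> // q qp ?; apply: h => //; [left|right].
- move=> [/starP[Up hU] /starP[Vp hV]]; split; apply/starP; split=> //.
  + by left.
  + by move=> q qp [/(hU _ qp)|/(hV _ qp)].
  + by move=> q qp [/(hU _ qp)].
Qed.

End Path_order.

(** * Coding of paths by a start state and a list of steps *)

Section Decode.
Context (A : eqType) (X : Type).

Fixpoint decode_fun (x : X) (l : seq (option A * X)) (s : seq (option A))
    {struct s} : option X :=
  match s, l with
  | [::], _ => Some x
  | a :: s', (b, y) :: l' => if a == b then decode_fun y l' s' else None
  | _ :: _, [::] => None
  end.

Lemma decode_fun_dom x l s : isSome (decode_fun x l s) = prefix s (unzip1 l).
Proof.
elim: s x l => [|a s IH] x [|[b y] l] //=.
by case: eqP => // _; exact: IH.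
Qed.

Definition decode (x : X) (l : seq (option A * X)) : Path A X :=
  MkPath (ex_intro _ (unzip1 l) (decode_fun_dom x l)).

(** Induction on the word generating the domain: removing its first letter [a] leaves the path
    [fun t => f (a :: t)]. *)
Lemma decode_surj (p : Path A X) : exists x l, p = decode x l.
Proof.
suff [x [l h]] : exists x l, path_fun p =1 decode_fun x l.
  by exists x, l; exact: eq_Path.
case: p => f [s] /=; elim: s f => [|a s IH] f hf.
  have := hf [::]; case e : (f [::]) => [x|]// _; exists x, [::] => -[//|b t] /=.
  by have := hf (b :: t); case: (f _).
have [|y [l h]] := IH (fun t => f (a :: t)).
  by move=> t; rewrite hf prefix_cons eqxx.
have := hf [::]; case e : (f [::]) => [x|]// _.
exists x, ((a, y) :: l) => -[//|b t] /=; have [->|ba] := eqVneq b a.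
  exact: h.
by have := hf (b :: t); rewrite prefix_cons (negbTE ba)/=; case: (f _).
Qed.

Lemma decode_cat_le x l m : path_le (decode x l) (decode x (l ++ m)).
Proof.
have h s : isSome (decode_fun x l s) ->
    decode_fun x (l ++ m) s = decode_fun x l s.
  elim: s x l => [|a s IH] x [|[b y] l] //=.
  by case: (a =P b) => // _; exact: IH.
by split=> s ds; last exact: h; rewrite /path_dom/= h.
Qed.

(** With [decode_cat_le], this turns the order on paths into extension of lists, on which weights
    are multiplicative. *)
Lemma decode_leP x l p :
  path_le (decode x l) p -> exists m, p = decode x (l ++ m).
Proof.
have [y [k ->]] := decode_surj p; move=> [_ h].
suff [-> [m ->]] : y = x /\ exists m, k = l ++ m by exists m.
have {}h s : isSome (decode_fun x l s) -> decode_fun y k s = decode_fun x l s.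
  exact: h.
elim: l x y k h => [|[a z] l IH] x y k h.
  by split; [case: (h [::] isT) | exists k].
split; first by case: (h [::] isT).
case: k h => [|[b w] k] h.
  by have := h [:: a]; rewrite /= eqxx => /(_ isT).
have ab : a = b.
  by have := h [:: a]; rewrite /= eqxx => /(_ isT); case: eqP.
rewrite -{b}ab in h *.
have [|-> [m ->]] := IH z w k; last by exists m.
by move=> s ds; have := h (a :: s); rewrite /= eqxx; exact.
Qed.

Lemma decode_inj x l m : decode x l = decode x m -> l = m.
Proof.
move=> e.
have {}e s : decode_fun x l s = decode_fun x m s.
  by rewrite -[LHS]/(decode x l s) e.
elim: l x m e => [|[a y] l IH] x [|[b z] m] //= h.
- by have := h [:: b]; rewrite /= eqxx.
- by have := h [:: a]; rewrite /= eqxx.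
- have := h [:: a]; rewrite /= eqxx; case: eqP => // ab [yz]; subst b z.
  congr cons; apply: (IH y) => s.
  by have := h (a :: s); rewrite /= eqxx.
Qed.

End Decode.

(** * Weights of step lists and their agreement with [muP] *)

Section Measure.
Context (R : realType) (A X : countType) (P : X -> option A -> X -> R)
  (hP : fully_probabilistic P).

Fixpoint weight (x : X) (l : seq (option A * X)) : R :=
  if l is (a, y) :: l' then P x a y * weight y l' else 1.

Lemma weight_ge0 x l : 0 <= weight x l.
Proof.
elim: l x => [|[a y] l IH] x //=.
by rewrite mulr_ge0//; exact: fp_ge0 hP _ _ _.
Qed.

Lemma weight_cat x l m :
  weight x (l ++ m) = weight x l * weight (last x (unzip2 l)) m.
Proof.
by elim: l x => [|[a y] l IH] x /=; rewrite ?mul1r// IH mulrA.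
Qed.

Definition steps (p : Path A X) : set (seq (option A) * option A) :=
  [set sa | path_dom p (rcons sa.1 sa.2)].

Definition shift (a : option A) (sa : seq (option A) * option A) :=
  (a :: sa.1, sa.2).

Lemma steps_nil x : steps (decode x [::]) = set0.
Proof. by apply/seteqP; split=> [[[|b s] a]|]. Qed.

(** Splits the index set of the product in [muP] into the first step and the shifted later ones,
    matching the recursion of [weight]. *)
Lemma steps_cons x a y l :
  steps (decode x ((a, y) :: l)) = [set ([::], a)] `|` shift a @` steps (decode y l).
Proof.
apply/seteqP; split=> [[[|b s] c]|_ [->|[[s c] h <-]]];
  rewrite /steps /path_dom/= ?eqxx//.
- by case: eqP => // -> _; left.
- by case: eqP => // -> h; right; exists (s, c).
Qed.

Lemma step_prob_shift x a y l s c :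
  step_prob P (decode x ((a, y) :: l)) (a :: s) c = step_prob P (decode y l) s c.
Proof. by rewrite /step_prob/= eqxx. Qed.

Lemma steps_finite x l : finite_set (steps (decode x l)).
Proof.
elim: l x => [|[a y] l IH] x; first by rewrite steps_nil.
by rewrite steps_cons finite_setU; split=> //; exact: finite_image.
Qed.

Lemma prod_steps x l :
  \big[*%R/1]_(sa \in steps (decode x l)) step_prob P (decode x l) sa.1 sa.2
  = weight x l.
Proof.
elim: l x => [|[a y] l IH] x; first by rewrite steps_nil fsbig_set0.
rewrite steps_cons fsbigU0//=; last 2 first.
- exact/finite_image/steps_finite.
- by move=> _ [-> [[s c] _ []]].
rewrite fsbig_set1 fsbig_image; last by move=> [s c] [t d] _ _ [-> ->].
rewrite -IH; congr (_ * _).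
  by rewrite /step_prob/= eqxx.
by apply: eq_fsbigr => -[s c] _; rewrite /= step_prob_shift.
Qed.

Lemma weight_execution x l :
  weight x l != 0 -> execution_from P x (decode x l).
Proof.
move=> w0; split=> //.
elim: l x w0 => [|[a y] l IH] x /=; first by move=> _ [|b s].
rewrite mulf_eq0 negb_or => /andP[P0 /IH h] [|b s] c.
  rewrite /path_dom /step_prob/=; case: eqP => // -> _.
  by rewrite lt_def P0; exact: fp_ge0 hP _ _ _.
rewrite /path_dom/=; case: eqP => // -> d.
by rewrite step_prob_shift; exact: h.
Qed.

(** Off executions [muP] is 0, and so is the weight, by contraposition of [weight_execution]. *)
Lemma muP_decode x l : muP P (decode x l) = weight x l.
Proof.
rewrite /muP; case: asboolP => [_|h]; first exact: prod_steps.
apply/esym/eqP; apply: contrapT => /negP w0; apply: h; exists x.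
exact: weight_execution.
Qed.

Lemma muP_ge0 p : 0 <= muP P p.
Proof.
by have [x [l ->]] := decode_surj p; rewrite muP_decode; exact: weight_ge0.
Qed.

Local Open Scope ereal_scope.

(** * Kraft's inequality *)

Lemma esum_step_le1 x :
  \esum_(ax in [set: option A * X]) (P x ax.1 ax.2)%:E <= 1.
Proof. by case: (fp_sum hP x) => ->. Qed.

Lemma esum_antichain_bounded_le1 n x (S : set (seq (option A * X))) :
  (forall l, S l -> (size l <= n)%N) ->
  (forall l m, S l -> S (l ++ m) -> m = [::]) ->
  \esum_(l in S) (weight x l)%:E <= 1.
Proof.
(* Every list extends [[::]], so if [S] contains [[::]] it contains nothing else and the sum is 1.
   This settles one case for both [n = 0] and the successor. *)
elim: n x S => [|n IH] x S hn hS; (have [S0|S0] := pselect (S [::]);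
  first by (rewrite (_ : S = [set [::]]) ?esum_set1//;
    apply/seteqP; split=> [l Sl|l ->//]; exact: hS S0 _)).
  rewrite (_ : S = set0) ?esum_set0//.
  by apply/seteqP; split=> // -[//|? ?] /hn.
(* Grouping by first step: the tails after [ax] form an antichain with length bound [n], so each
   group sums to at most the probability of [ax]. *)
have -> : S = \bigcup_ax (cons ax @` [set l | S (ax :: l)]).
  apply/seteqP; split=> [[//|ax l] Sl|_ [ax _ [l Sl <-]]//].
  by exists ax => //; exists l.
rewrite esum_disjoint_bigcup; last 2 first.
- by move=> ax bx _ _ [_ [[l _ <-] [m _ [->]]]].
- by move=> l; rewrite lee_fin weight_ge0.
apply: le_trans (esum_step_le1 x); apply: le_esum => -[a y] _ /=.
rewrite esum_image; last by move=> l m _ _ [].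
apply: esum_scale_le; first exact: fp_ge0 hP _ _ _.
by apply: IH => [l /hn//|l m Sl Slm]; exact: hS Sl Slm.
Qed.

(** The sum is a supremum over finite subsets, and in each of these the lengths are bounded. *)
Lemma esum_antichain_le1 x (S : set (seq (option A * X))) :
  (forall l m, S l -> S (l ++ m) -> m = [::]) ->
  \esum_(l in S) (weight x l)%:E <= 1.
Proof.
move=> hS; apply: ge_ereal_sup => _ [F [finF FS] <-].
rewrite -esum_fset//; last by move=> l _; rewrite lee_fin weight_ge0.
have [n hn] : exists n, forall l, F l -> (size l <= n)%N.
  exists (\max_(l <- fset_set F) size l)%N => l Fl.
  by apply: leq_bigmax_seq => //; rewrite in_fset_set//; exact: mem_set.
by apply: (esum_antichain_bounded_le1 _ hn) => l m /FS Sl /FS; exact: hS.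
Qed.

Lemma esum_antichain_above_le p (S : set (Path A X)) :
  (forall q, S q -> path_le p q) ->
  (forall q r, S q -> S r -> path_le q r -> q = r) ->
  \esum_(q in S) (muP P q)%:E <= (muP P p)%:E.
Proof.
have [x [l ->]] := decode_surj p; move=> pS hS.
(* The continuations [m] of [l] parametrise [S] injectively and form an antichain; [weight x l] is a
   common factor. *)
have -> : S = (fun m => decode x (l ++ m)) @` [set m | S (decode x (l ++ m))].
  apply/seteqP; split=> [q Sq|_ [m Sm <-]//].
  by have [m qE] := decode_leP (pS _ Sq); exists m; rewrite /= -?qE.
rewrite esum_image; last first.
  move=> m k _ _ lmk; have := congr1 (drop (size l)) (decode_inj lmk).
  by rewrite !drop_size_cat.
rewrite muP_decode.
under eq_esum do rewrite muP_decode weight_cat.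
apply: esum_scale_le; first exact: weight_ge0.
apply: esum_antichain_le1 => m k /= Sm Smk.
have := hS _ _ Sm Smk; rewrite catA => /(_ (decode_cat_le _ _ _)) lmk.
have := congr1 (drop (size (l ++ m))) (decode_inj lmk).
by rewrite drop_size drop_size_cat.
Qed.

(** * The valuation axioms, local finiteness and Scott continuity *)

Lemma muP_tilde_mono (U V : set (Path A X)) :
  U `<=` V -> muP_tilde P U <= muP_tilde P V.
Proof.
move=> UV; rewrite /muP_tilde.
pose J p := [set q | [/\ star U q, star V p & path_le p q]].
have -> : star U = \bigcup_(p in star V) J p.
  apply/seteqP; split=> [q Uq|q [p _ []]//].
  have [p Vp pq] := star_below (UV _ Uq.1).
  by exists p.
rewrite esum_disjoint_bigcup; last 2 first.
(* Two elements of [star V] below the same [q] are comparable, hence equal by minimality. *)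
- move=> p r _ _ [q [[_ /starP[Vp hp] pq] [_ /starP[Vr hr] rq]]].
  by have [pr|rp] := path_le_total pq rq; [exact: hr | apply/esym; exact: hp].
- by move=> p; rewrite lee_fin muP_ge0.
apply: le_esum => p _; apply: esum_antichain_above_le => [q []//|q r].
by move=> [/starP[Uq _] _ _] [/starP[_ hr] _ _] qr; exact: hr.
Qed.

Lemma muP_tilde_modular (U V : set (Path A X)) :
  up_closed U -> up_closed V ->
  muP_tilde P U + muP_tilde P V =
  muP_tilde P (U `|` V) + muP_tilde P (U `&` V).
Proof.
move=> hU hV; have mu0 p : 0 <= (muP P p)%:E by rewrite lee_fin muP_ge0.
rewrite /muP_tilde esumU_add_esumI// [RHS]esumU_add_esumI//.
by rewrite starU_starI// starU_cap_starI.
Qed.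

Lemma muP_tilde_valuation : valuation (muP_tilde P).
Proof.
split.
- by move=> U _; apply: esum_ge0 => p _; rewrite lee_fin muP_ge0.
- rewrite /muP_tilde (_ : star set0 = set0) ?esum_set0//.
  by apply/seteqP; split=> // p [].
- by move=> U V _ _; exact: muP_tilde_mono.
- by move=> U V /open_PathE hU /open_PathE hV; exact: muP_tilde_modular.
Qed.

(** The upward closure of [p] is an open neighbourhood whose only minimal element is [p], so its
    value is the real number [muP P p]. *)
Lemma muP_tilde_locally_finite : locally_finite_valuation (muP_tilde P).
Proof.
move=> p; exists [set q | path_le p q]; split.
- by apply/open_PathE => q r; exact: path_le_trans.
- exact: path_le_refl.
- rewrite /muP_tilde (_ : star _ = [set p]).
    by rewrite esum_set1 ?ltry// lee_fin muP_ge0.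
  apply/seteqP; split=> [q /starP[/= pq h]|_ ->].
    by apply/esym; apply: h => //; exact: path_le_refl.
  by apply/starP; split=> [|q qp pq]; [exact: path_le_refl | exact: path_le_anti].
Qed.

(** Induction on the finite set; nonemptiness of the family supplies an index for the empty set. *)
Lemma directed_family_finite (T : choiceType) (I : Type) (F : I -> set T)
    (S : set T) : directed_family F -> finite_set S -> S `<=` \bigcup_i F i ->
  exists i, S `<=` F i.
Proof.
move=> [[i0] dF] finS; rewrite -(fset_setK finS).
elim/finSet_rect: (fset_set S) => {S finS} S IH SF.
have [->|/fset0Pn[t tS]] := eqVneq S fset0; first by exists i0 => t; rewrite /= inE.
have [|u|i hi] := IH (S `\ t)%fset.
- exact: fproperD1.
- by move=> /= /fsetD1P[_ uS]; exact: SF.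
have [j _ Fjt] := SF t tS; have [k [ik jk]] := dF i j.
exists k => u /= uS; have [->|ut] := eqVneq u t; first exact: jk.
by apply/ik/hi; rewrite /= !inE ut.
Qed.

Lemma muP_tilde_scott : scott_continuous (muP_tilde P).
Proof.
move=> I F oF dF; apply/eqP; rewrite eq_le; apply/andP; split; last first.
  by apply: ge_ereal_sup => _ [i _ <-]; apply: muP_tilde_mono; exact: bigcup_sup.
apply: ge_ereal_sup => _ [S [finS SF] <-].
have [|i Si] := directed_family_finite dF finS; first by move=> p /SF[].
apply: (@le_trans _ _ (muP_tilde P (F i))); last first.
  by apply: ereal_sup_ubound; exists i.
(* A path minimal in the union stays minimal in any member [F i] that contains it. *)
apply: esum_ge; exists S => //; split=> // p Sp; apply/starP; split; first exact: Si.
move=> q qp Fq; have /starP[_] := SF _ Sp; apply=> //; by exists i.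
Qed.

End Measure.

Theorem theorem49 (R : realType) (A X : countType)
    (P : X -> option A -> X -> R) (hP : fully_probabilistic P) :
  [/\ valuation (muP_tilde P),
      locally_finite_valuation (muP_tilde P)
    & scott_continuous (muP_tilde P)].
Proof.
split.
- exact: muP_tilde_valuation.
- exact: muP_tilde_locally_finite.
- exact: muP_tilde_scott.
Qed.
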